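(* Let $\mathcal{R}$ be a commutative ring with unity and let $\mathcal{A}$ be an $\mathcal{R}$-algebra with unity $I$ which has a set of left triangulating idempotents $\{E_1,\dots,E_n\}$, with the corresponding generalized triangular matrix representation \[ \mathcal{A}=\begin{pmatrix} \mathcal{A}_{11} & \mathcal{A}_{12} & \cdots & \mathcal{A}_{1n}\\ 0 & \mathcal{A}_{22} & \cdots & \mathcal{A}_{2n}\\ \vdots & \vdots & \ddots & \vdots\\ 0 & 0 & \cdots & \mathcal{A}_{nn}\end{pmatrix},\qquad \mathcal{A}_{ij}\cong E_i\mathcal{A}E_j. \] Suppose that $l.ann_{F\mathcal{A}F}F\mathcal{A}E_n=\{0\}$, where $F=I-E_n$, and that, for all $1\leq k\leq n$, any local left multiplier from $\mathcal{A}_{nn}$ into $\mathcal{A}_{kn}$ is a left multiplier. Then $\mathcal{A}$ is a SLIP algebra.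
   Context: All algebras are associative $\mathcal{R}$-algebras with unity and all modules and bimodules are unital; modules over an $\mathcal{R}$-algebra are $\mathcal{R}$-modules in the compatible way. An idempotent $e$ of an algebra $\mathcal{C}$ is left semicentral if $\mathcal{C}e=e\mathcal{C}e$; $\mathcal{S}_l(\mathcal{C})$ is the set of left semicentral idempotents of $\mathcal{C}$. An ordered set $\{e_1,\dots,e_n\}$ of nonzero distinct idempotents in $\mathcal{A}$ is a set of left triangulating idempotents if (i) $1=e_1+\cdots+e_n$; (ii) $e_1\in\mathcal{S}_l(\mathcal{A})$; (iii) $e_{k+1}\in\mathcal{S}_l(f_k\mathcal{A}f_k)$, where $f_k=1-(e_1+\cdots+e_k)$, for $1\leq k\leq n-1$. Such a set induces an isomorphism of $\mathcal{A}$ with the algebra of upper triangular $n\times n$ matrices whose $(i,j)$-entries ($i\le j$) lie in $e_i\mathcal{A}e_j$, under the usual matrix operations, $e_i$ corresponding to the matrix with the unity of $e_i\mathcal{A}e_i$ in position $(i,i)$ and $0$ elsewhere. For an idempotent $e$, $e\mathcal{A}e$ is an algebra with unity $e$. For a left $\mathcal{C}$-module $\mathcal{M}$, $l.ann_{\mathcal{C}}\mathcal{M}=\{c\in\mathcal{C}: c\mathcal{M}=\{0\}\}$. For an algebra $\mathcal{C}$ and a right $\mathcal{C}$-module $\mathcal{X}$, an $\mathcal{R}$-linear map $\psi:\mathcal{C}\to\mathcal{X}$ is a left multiplier if $\psi(c)=\psi(1)c$ for all $c\in\mathcal{C}$; it is a local left multiplier if for each $c\in\mathcal{C}$ there exists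 $x_c\in\mathcal{X}$ with $\psi(c)=x_c c$. An $\mathcal{R}$-linear map $\psi:\mathcal{C}\to\mathcal{C}$ is LIP (left-ideal-preserving) if $\psi(\mathcal{J})\subseteq\mathcal{J}$ for every left ideal $\mathcal{J}$ of $\mathcal{C}$ (equivalently, $\psi$ is a local left multiplier from $\mathcal{C}$ to $\mathcal{C}$). The algebra $\mathcal{C}$ is SLIP if every LIP map on $\mathcal{C}$ is a left multiplier. *)

(* Defs.v *)
From HB Require Import structures.
From mathcomp Require Import all_boot all_order all_algebra.
From mathcomp Require Import boolp classical_sets.

Set Implicit Arguments.
Unset Strict Implicit.
Unset Printing Implicit Defensive.

Import GRing.Theory.

Local Open Scope classical_set_scope.
Local Open Scope ring_scope.

(* A unital right C-module structure, compatible with R, on the R-module X.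
   (Encoding it as [lmodType C^c] would compete with the R-module structure.) *)
Record ractType (R : comPzRingType) (C : algType R) (X : lmodType R) := RAct {
  ract_fun :> X -> C -> X;
  _ : forall x, ract_fun x 1 = x;
  _ : forall x c d, ract_fun x (c * d) = ract_fun (ract_fun x c) d;
  _ : forall x y c, ract_fun (x + y) c = ract_fun x c + ract_fun y c;
  _ : forall x c d, ract_fun x (c + d) = ract_fun x c + ract_fun x d;
  _ : forall r x c, ract_fun (r *: x) c = r *: ract_fun x c;
  _ : forall r x c, ract_fun x (r *: c) = r *: ract_fun x c
}.

Section Multipliers.
Variables (R : comPzRingType) (C : algType R).

Definition regular_ract : ractType C C.
Proof.
exists (fun x c => x * c).
- exact: mulr1.
- exact: mulrA.
- by move=> x y c; rewrite mulrDl.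
- by move=> x c d; rewrite mulrDr.
- by move=> r x c; rewrite scalerAl.
- by move=> r x c; rewrite scalerAr.
Defined.

Definition left_multiplier (X : lmodType R) (act : ractType C X)
    (psi : {linear C -> X}) : Prop :=
  forall c, psi c = act (psi 1) c.

Definition local_left_multiplier (X : lmodType R) (act : ractType C X)
    (psi : {linear C -> X}) : Prop :=
  forall c, exists x, psi c = act x c.

Definition left_ideal (J : set C) : Prop :=
  [/\ J 0, forall x y, J x -> J y -> J (x + y) & forall c x, J x -> J (c * x)].

Definition LIP (psi : {linear C -> C}) : Prop :=
  forall J : set C, left_ideal J -> psi @` J `<=` J.

Definition SLIP : Prop :=
  forall psi : {linear C -> C}, LIP psi -> left_multiplier regular_ract psi.

End Multipliers.

Section Peirce.
Variables (R : comPzRingType) (A : algType R).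

(* The set eAf *)
Definition peirce (e f : A) : set A := [set e * a * f | a in [set: A]].

(* [C] is (the carrier of) A itself or of a corner fAf, with the product of A. *)
Definition left_semicentral (C : set A) (e : A) : Prop :=
  [/\ C e, e * e = e & [set c * e | c in C] = [set e * c * e | c in C]].

Definition lann (C M : set A) : set A :=
  [set c | C c /\ forall x, M x -> c * x = 0].

Record nz_idem := NzIdem {
  idem_val :> A;
  idemM : idem_val * idem_val = idem_val;
  idem_neq0 : idem_val != 0
}.

(* The indices are shifted by one: [E i] is e_(i+1), for a family of length
   n = m.+1, and [1 - \sum_(i | i < k) E i] is f_k. *)
Definition left_triangulating (m : nat) (E : 'I_m.+1 -> nz_idem) : Prop :=
  [/\ injective (fun i => E i : A),
      1 = \sum_i (E i : A),
      left_semicentral [set: A] (E ord0)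
    & forall k : 'I_m.+1, (0 < k)%N ->
        let f := 1 - \sum_(i < m.+1 | (i < k)%N) (E i : A) in
        left_semicentral (peirce f f) (E k)].

Record peirce_type (e f : A) := Peirce {
  peirce_val :> A;
  peirce_valP : peirce_val \in peirce e f
}.

End Peirce.

Section PeirceModule.
Variables (R : comPzRingType) (A : algType R) (e f : A).

Definition peirce_pred : {pred A} := fun x => x \in peirce e f.

Fact peirce_submod_closed : submod_closed peirce_pred.
Proof.
split; first by apply/mem_set; exists 0; rewrite ?mulr0 ?mul0r.
move=> r _ _ /set_mem[a _ <-] /set_mem[b _ <-]; apply/mem_set.
by exists (r *: a + b) => //; rewrite mulrDr mulrDl -scalerAr -scalerAl.
Qed.
HB.instance Definition _ :=
  GRing.isSubmodClosed.Build R A peirce_pred peirce_submod_closed.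

HB.instance Definition _ :=
  [isSub of @peirce_type R A e f for @peirce_val R A e f].
HB.instance Definition _ := [Choice of @peirce_type R A e f by <:].
HB.instance Definition _ :=
  GRing.SubChoice_isSubLmodule.Build R A peirce_pred (@peirce_type R A e f)
    peirce_submod_closed.

End PeirceModule.

Section PeirceProduct.
Variables (R : comPzRingType) (A : algType R).

Fact peirce_mul_subproof (e f g : A) (x : peirce_type e f)
  (y : peirce_type f g) : (x : A) * (y : A) \in peirce e g.
Proof.
case: x y => [_ /= /set_mem[a _ <-]] [_ /= /set_mem[b _ <-]]; apply/mem_set.
by exists (a * f * f * b) => //; rewrite !mulrA.
Qed.

Definition peirce_mul (e f g : A) (x : peirce_type e f) (y : peirce_type f g) :
  peirce_type e g := Peirce (peirce_mul_subproof x y).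

Fact peirce_one_subproof (e : nz_idem A) : (e : A) \in peirce e e.
Proof. by apply/mem_set; exists 1; rewrite // mulr1 idemM. Qed.

Lemma peirce_idemr (e : A) (f : nz_idem A) (x : peirce_type e f) :
  (x : A) * (f : A) = x :> A.
Proof. by case: x => _ /= /set_mem[a _ <-]; rewrite -mulrA idemM. Qed.

Lemma peirce_ideml (e : nz_idem A) (f : A) (x : peirce_type e f) :
  (e : A) * (x : A) = x :> A.
Proof. by case: x => _ /= /set_mem[a _ <-]; rewrite !mulrA idemM. Qed.

Definition corner (e : nz_idem A) : Type := peirce_type e e.

Section Corner.
Variable e : nz_idem A.

HB.instance Definition _ := GRing.Lmodule.on (corner e).

Definition corner_one : corner e := Peirce (peirce_one_subproof e).
Definition corner_mul (x y : corner e) : corner e := peirce_mul x y.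

Fact corner_mulA : associative corner_mul.
Proof. by move=> x y z; apply: val_inj; rewrite /= mulrA. Qed.
Fact corner_mul1 : left_id corner_one corner_mul.
Proof. by move=> x; apply: val_inj; rewrite /= peirce_ideml. Qed.
Fact corner_mulr1 : right_id corner_one corner_mul.
Proof. by move=> x; apply: val_inj; rewrite /= peirce_idemr. Qed.
Fact corner_mulDl : left_distributive corner_mul +%R.
Proof. by move=> x y z; apply: val_inj; rewrite /= mulrDl. Qed.
Fact corner_mulDr : right_distributive corner_mul +%R.
Proof. by move=> x y z; apply: val_inj; rewrite /= mulrDr. Qed.
Fact corner_one_neq0 : corner_one != 0.
Proof. by rewrite -val_eqE /= (idem_neq0 e). Qed.

HB.instance Definition _ := GRing.Zmodule_isNzRing.Build (corner e)
  corner_mulA corner_mul1 corner_mulr1 corner_mulDl corner_mulDr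
  corner_one_neq0.

Fact corner_scaleAl (r : R) (x y : corner e) : r *: (x * y) = r *: x * y.
Proof. by apply: val_inj; rewrite /= scalerAl. Qed.
HB.instance Definition _ := GRing.Lmodule_isLalgebra.Build R (corner e)
  corner_scaleAl.

Fact corner_scaleAr (r : R) (x y : corner e) : r *: (x * y) = x * (r *: y).
Proof. by apply: val_inj; rewrite /= scalerAr. Qed.
HB.instance Definition _ := GRing.Lalgebra_isAlgebra.Build R (corner e)
  corner_scaleAr.

End Corner.

(* eAf as a right module over the algebra fAf *)
Definition peirce_ract (e : A) (f : nz_idem A) :
  ractType (corner f) (peirce_type e f).
Proof.
exists (fun x c => @peirce_mul e f f x c).
- by move=> x; apply: val_inj; rewrite /= peirce_idemr.
- by move=> x c d; apply: val_inj; rewrite /= mulrA.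
- by move=> x y c; apply: val_inj; rewrite /= mulrDl.
- by move=> x c d; apply: val_inj; rewrite /= mulrDr.
- by move=> r x c; apply: val_inj; rewrite /= scalerAl.
- by move=> r x c; apply: val_inj; rewrite /= scalerAr.
Defined.

End PeirceProduct.

(* Main.v *)
Require Import Defs.
From HB Require Import structures.
From mathcomp Require Import all_boot all_order all_algebra.
From mathcomp Require Import boolp classical_sets.

(** Write e for the last idempotent E_n and F = 1 - e.  A LIP map psi sends
    each a into the left ideal A a, and subtracting the left multiplication by
    psi 1 gives a map phi with the same property and phi 1 = 0; the claim is
    that phi = 0.

    Upper triangularity enters only through e A F = 0
    ([left_triangulating_last]), so that A = FAF + FAe + eAe.  The multiplier
    hypothesis is applied to the components c |-> E_k (psi c) of psi on the
    corner eAe; it yields phi c = phi e * c there ([corner_multiplier]).  The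
    remaining argument ([local_map_eq0]) compares values of phi at a and at
    perturbations of a:
    - phi e lies in A e and phi F lies in A F, while phi e + phi F = phi 1 = 0;
      hence phi e = phi F = 0, and phi vanishes on eAe.
    - for x in FAe, phi x = phi (F + x) is some y * (F + x); its part in A F
      is y * F, which must be 0, so phi x = y * F * x = 0.
    - for a in AF and x in FAe, phi a = phi (a + a * x) is some
      y * (a + a * x); comparing the parts in A F and in A e gives
      phi a = y * a and 0 = y * a * x, that is, phi a * x = 0.  Thus phi a
      annihilates FAe, and the annihilator hypothesis gives phi a = 0. *)

Set Implicit Arguments.
Unset Strict Implicit.
Unset Printing Implicit Defensive.

Import GRing.Theory.

Local Open Scope classical_set_scope.
Local Open Scope ring_scope.

Section TriangulatingIdempotents.
Variables (R : comPzRingType) (A : algType R).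

(** The invariant carried by the tails f_k of a triangulating family: such an
    f is right semicentral, i.e. f A = f A f. *)
Definition right_semicentral (f : A) : Prop :=
  f * f = f /\ forall a, f * a * (1 - f) = 0.

Lemma peirce11 : peirce (1 : A) 1 = [set: A].
Proof.
by apply/seteqP; split=> // a _; exists a => //; rewrite mul1r mulr1.
Qed.

(** With f' = f - e one has f' A (1 - f') = f' A (1 - f) + f' A e.  The first
    summand vanishes because f' = f' f, the second because f A e = e A e by
    semicentrality while f' e = 0. *)
Lemma right_semicentralB (f e : A) :
  right_semicentral f -> left_semicentral (peirce f f) e ->
  right_semicentral (f - e).
Proof.
move=> [ff fA] [[b _ be] ee eC].
have fe : f * e = e by rewrite -be !mulrA ff.
have ef : e * f = e by rewrite -be -mulrA ff.
have f'e : (f - e) * e = 0 by rewrite mulrBl fe ee subrr.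
have f'f : (f - e) * f = f - e by rewrite mulrBl ff ef.
split=> [|a]; first by rewrite mulrBr f'e subr0 f'f.
have f'ae : (f - e) * a * e = 0.
  have : [set c * e | c in peirce f f] (f * a * f * e).
    by exists (f * a * f) => //; exists a.
  rewrite eC => -[c _ ce].
  have -> : (f - e) * a * e = (f - e) * (f * a * f * e).
    by rewrite -(mulrA (f * a)) fe !mulrA f'f.
  by rewrite -ce !mulrA f'e !mul0r.
have -> : 1 - (f - e) = (1 - f) + e by rewrite opprB addrA addrAC.
by rewrite mulrDr f'ae addr0 -{1}f'f -!mulrA (mulrA f) fA mulr0.
Qed.

Lemma left_triangulating_last (m : nat) (E : 'I_m.+1 -> nz_idem A) :
  left_triangulating E -> right_semicentral (E ord_max).
Proof.
move=> [_ E1 E0 ES].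
pose f k : A := 1 - \sum_(i < m.+1 | (i < k)%N) (E i : A).
have f0 : f 0%N = 1 by rewrite /f big_pred0 ?subr0.
have fS (k : 'I_m.+1) : f k.+1 = f k - (E k : A).
  rewrite /f (bigD1 k) //= opprD addrCA addrC; congr (1 - _ - _).
  by apply: eq_bigl => i; rewrite ltnS [in RHS]ltn_neqAle andbC -val_eqE.
have fm : f m = E ord_max.
  rewrite /f E1 (bigD1 ord_max) //= (eq_bigl (fun i : 'I_m.+1 => (i < m)%N)) ?addrK //.
  by move=> i; rewrite -val_eqE /= [RHS]ltn_neqAle -ltnS ltn_ord andbT.
have fR k : (k <= m)%N -> right_semicentral (f k).
  elim: k => [|k IHk] km.
    by rewrite f0; split=> [|a]; rewrite ?mulr1 // subrr mulr0.
  have k_ord : (k < m.+1)%N by rewrite ltnS ltnW.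
  rewrite (fS (Ordinal k_ord)); apply: right_semicentralB.
    exact/IHk/ltnW.
  case: k {IHk} km k_ord => [|k] km k_ord.
    by rewrite f0 peirce11 (_ : Ordinal _ = ord0) //; apply: val_inj.
  exact: (ES (Ordinal k_ord)).
by rewrite -fm; exact: fR.
Qed.

End TriangulatingIdempotents.

Section LocalMaps.
Variables (R : comPzRingType) (A : algType R).

(** Test left ideal preservation on the principal left ideal A a. *)
Lemma LIP_local (psi : {linear A -> A}) :
  LIP psi -> forall a, exists x, psi a = x * a.
Proof.
move=> psiL a.
have idA : left_ideal [set x * a | x in [set: A]].
  split; first by exists 0; rewrite ?mul0r.
    by move=> _ _ [x _ <-] [y _ <-]; exists (x + y); rewrite ?mulrDl.
  by move=> c _ [x _ <-]; exists (c * x); rewrite ?mulrA.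
have [|x _ <-] := psiL _ idA (psi a); last by exists x.
by exists a => //; exists 1; rewrite ?mul1r.
Qed.

Lemma local_map_eq0 (e : A) (phi : {linear A -> A}) :
  right_semicentral e ->
  lann (peirce (1 - e) (1 - e)) (peirce (1 - e) e) = [set 0] ->
  (forall a, exists x, phi a = x * a) ->
  phi 1 = 0 ->
  (forall a, phi (e * a * e) = phi e * (e * a * e)) ->
  forall a, phi a = 0.
Proof.
move=> [ee]; set F := 1 - e => eA annF phi_loc phi1 phie.
have eF : e * F = 0 by rewrite mulrBr mulr1 ee subrr.
have Fe : F * e = 0 by rewrite mulrBl mul1r ee subrr.
have FF : F * F = F by rewrite {1}/F mulrBl eF mul1r subr0.
have FDe : F + e = 1 by rewrite subrK.
(* Otherwise distributivity would also rewrite the products by 1 - e. *)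
clearbody F.
have phiFDe : phi F + phi e = 0 by rewrite -linearD FDe.
have phie0 : phi e = 0.
  have [x px] := phi_loc e; have [y py] := phi_loc F.
  move/(congr1 ( *%R^~ e)): (phiFDe).
  by rewrite mul0r px py mulrDl -!mulrA Fe mulr0 add0r ee.
have phiF0 : phi F = 0 by rewrite -phiFDe phie0 addr0.
have phiFAe b : phi (F * b * e) = 0.
  have [y py] := phi_loc (F + F * b * e).
  have [x px] := phi_loc (F * b * e).
  move: py; rewrite linearD phiF0 add0r => py.
  have yF : y * F = 0.
    move/(congr1 ( *%R^~ F)): (py).
    by rewrite px mulrDr mulrDl -!mulrA eF !mulr0 addr0 FF.
  by rewrite py mulrDr yF add0r !mulrA yF !mul0r.
have phiAe b : phi (b * e) = 0.
  by rewrite -[b]mul1r -FDe !mulrDl linearD phiFAe phie phie0 mul0r addr0.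
have phiAF b : phi (b * F) = 0.
  have [z pz] := phi_loc (b * F).
  (* Since e A F = 0, the left ideal A F is the corner F A F. *)
  have FAF c : c * F = F * c * F.
    by rewrite -[c in LHS]mul1r -FDe !mulrDl eA addr0.
  suff: [set 0] (phi (b * F)) by [].
  rewrite -annF; split.
    by exists (z * b) => //; rewrite -FAF pz mulrA.
  move=> _ [c _ <-].
  have [y py] := phi_loc (b * F + b * F * (F * c * e)).
  move: py; rewrite linearD mulrA phiAe addr0 => py.
  have pyF : phi (b * F) = y * (b * F).
    move/(congr1 ( *%R^~ F)): (py).
    by rewrite mulrDr mulrDl pz -!mulrA eF !mulr0 addr0 FF.
  move: (py); rewrite pyF mulrDr -[LHS]addr0 => /addrI.
  by rewrite !mulrA => <-.
by move=> a; rewrite -[a]mulr1 -FDe mulrDr linearD phiAF phiAe addr0.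
Qed.

End LocalMaps.

Section CornerComponents.
Variables (R : comPzRingType) (A : algType R) (e f : nz_idem A).

Fact peirce_proj_subproof (a : A) : (e : A) * a * (f : A) \in peirce (e : A) f.
Proof. by apply/mem_set; exists a. Qed.

Variable psi : {linear A -> A}.

(** For a psi sending each a into A a, psi c lies in A f, so that the right
    factor f changes nothing and this is just e * psi c; the factor serves to
    give the map a value in e A f whatever psi is. *)
Definition corner_component (c : corner f) : peirce_type e f :=
  Peirce (peirce_proj_subproof (psi (peirce_val c))).

Fact corner_component_linear : linear corner_component.
Proof.
move=> r x y; apply: val_inj => /=.
by rewrite linearP mulrDr mulrDl -scalerAr -scalerAl.
Qed.
HB.instance Definition _ := GRing.isLinear.Build R (corner f)
  (peirce_type e f) *:%R corner_component corner_component_linear.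

Lemma corner_component_local :
  (forall a, exists x, psi a = x * a) ->
  local_left_multiplier (peirce_ract e f) corner_component.
Proof.
move=> psi_loc c; have [x px] := psi_loc (peirce_val c).
exists (Peirce (peirce_proj_subproof x)); apply: val_inj => /=.
by rewrite px -!mulrA peirce_idemr peirce_ideml.
Qed.

End CornerComponents.

(** The components of psi on the corner of f reassemble because the E k sum to
    1. *)
Lemma corner_multiplier (R : comPzRingType) (A : algType R) (m : nat)
    (E : 'I_m.+1 -> nz_idem A) (f : nz_idem A) (psi : {linear A -> A}) :
  1 = \sum_i (E i : A) ->
  (forall (k : 'I_m.+1) (phi : {linear corner f -> peirce_type (E k) f}),
    local_left_multiplier (peirce_ract (E k) f) phi ->
    left_multiplier (peirce_ract (E k) f) phi) ->
  (forall a, exists x, psi a = x * a) ->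
  forall c : corner f, psi (peirce_val c) = psi (f : A) * peirce_val c.
Proof.
move=> E1 multE psi_loc c.
rewrite -[LHS]mul1r -[RHS]mul1r E1 !mulr_suml; apply: eq_bigr => k _.
have /(congr1 (@peirce_val _ _ _ _)) /= :=
  multE k _ (corner_component_local (E k) psi_loc) c.
have [x ->] := psi_loc (peirce_val c).
by rewrite -!mulrA peirce_idemr peirce_ideml.
Qed.

Theorem theorem4p3 (R : comPzRingType) (A : algType R) (m : nat)
    (E : 'I_m.+1 -> nz_idem A) :
  left_triangulating E ->
  (let En : A := E ord_max in
   let F : A := 1 - En in
   lann (peirce F F) (peirce F En) = [set 0]) ->
  (forall (k : 'I_m.+1)
      (psi : {linear corner (E ord_max) -> peirce_type (E k) (E ord_max)}),
    local_left_multiplier (peirce_ract (E k) (E ord_max)) psi ->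
    left_multiplier (peirce_ract (E k) (E ord_max)) psi) ->
  SLIP A.
Proof.
move=> triE annF multE psi /LIP_local psi_loc a /=.
have [_ E1 _ _] := triE.
pose phi : {linear A -> A} := psi \- (psi 1 \*o idfun).
apply/eqP; rewrite -subr_eq0; apply/eqP.
apply: (local_map_eq0 (phi := phi) (left_triangulating_last triE) annF).
- move=> b; have [x px] := psi_loc b.
  by exists (x - psi 1); rewrite /= px mulrBl.
- by rewrite /= mulr1 subrr.
- move=> b /=.
  have := corner_multiplier E1 multE psi_loc
    (Peirce (peirce_proj_subproof (E ord_max) (E ord_max) b)).
  by move=> /= ->; rewrite mulrBl !mulrA -[psi 1 * _ * (E ord_max : A)]mulrA idemM.
Qed.
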